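(* Let $\mathrm{FIM}_X$ be the monogenic free inverse monoid generated by $X=\{a\}$. Then: 1. $\mathcal{D}\text{-}\mathrm{Geo}(\mathrm{FIM}_X)$ is a regular language; 2. $\mathcal{R}\text{-}\mathrm{Geo}(\mathrm{FIM}_X)$ is a deterministic context-free (and so also co-context-free) language; 3. $\mathcal{L}\text{-}\mathrm{Geo}(\mathrm{FIM}_X)$ is a deterministic context-free (and so also co-context-free) language; 4. $\mathcal{H}\text{-}\mathrm{Geo}(\mathrm{FIM}_X)$ is a deterministic context-free (and so also co-context-free) language.
   Context: $\tilde X=\{a,a^{-1}\}$; $\pi:\tilde X^*\to \mathrm{FIM}_X$ is the canonical surjective homomorphism; $\ell(w)$ is the length of the word $w$. For $\mathcal{K}\in\{\mathcal{D},\mathcal{R},\mathcal{L},\mathcal{H}\}$ the corresponding Green's relation on $\mathrm{FIM}_X$, $$\mathcal{K}\text{-}\mathrm{Geo}(\mathrm{FIM}_X)=\bigl\{w\in\tilde X^*: \ell(w)=\min\{\ell(u): u\in\tilde X^*,\ (u\pi)\,\mathcal{K}\,(w\pi)\}\bigr\}.$$ A language is deterministic context-free if it is accepted (by final state) by a deterministic pushdown automaton; it is co-context-free if its complement in $\tilde X^*$ is context-free. *)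

(* Defs.v *)
From HB Require Import structures.
From mathcomp Require Import all_boot.
From mathcomp Require Import boolp classical_sets.
From Stdlib Require Import Relations.Relation_Operators.

Set Implicit Arguments.
Unset Strict Implicit.
Unset Printing Implicit Defensive.

Local Open Scope classical_set_scope.


Definition left_ideal (M : monoidType) (a : M) : set M :=
  [set (x * a)%g | x in [set: M]].
Definition right_ideal (M : monoidType) (a : M) : set M :=
  [set (a * x)%g | x in [set: M]].

Definition greenL (M : monoidType) (a b : M) : Prop :=
  left_ideal a = left_ideal b.
Definition greenR (M : monoidType) (a b : M) : Prop :=
  right_ideal a = right_ideal b.
Definition greenH (M : monoidType) (a b : M) : Prop :=
  greenL a b /\ greenR a b.
Definition greenD (M : monoidType) (a b : M) : Prop :=
  exists c : M, greenL a c /\ greenR c b.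

(* The free inverse monoid: words over X and formal inverses, modulo the
   Vagner congruence. The letter (x, true) is x and (x, false) is x^-1. *)

Notation letter X := (X * bool)%type.
Notation word X := (seq (letter X)).

Definition inv_letter (X : Type) (c : letter X) : letter X := (c.1, ~~ c.2).
Definition inv_word (X : Type) (w : word X) : word X :=
  rev (map (@inv_letter X) w).

Inductive vagner (X : Type) : word X -> word X -> Prop :=
| vagner_refl u : vagner u u
| vagner_sym u v : vagner u v -> vagner v u
| vagner_trans u v w : vagner u v -> vagner v w -> vagner u w
| vagner_cat u u' v v' : vagner u u' -> vagner v v' ->
    vagner (u ++ v) (u' ++ v')
| vagner_regular u : vagner (u ++ inv_word u ++ u) u
| vagner_idem_comm u v :
    vagner ((u ++ inv_word u) ++ (v ++ inv_word v))
           ((v ++ inv_word v) ++ (u ++ inv_word u)).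

Definition vagnerb (X : choiceType) : rel (word X) :=
  fun u v => `[< vagner u v >].

Lemma vagnerb_refl (X : choiceType) : reflexive (@vagnerb X).
Proof. by move=> u; apply/asboolP/vagner_refl. Qed.

Lemma vagnerb_sym (X : choiceType) : symmetric (@vagnerb X).
Proof. by move=> u v; apply/asboolP/asboolP => /vagner_sym. Qed.

Lemma vagnerb_trans (X : choiceType) : transitive (@vagnerb X).
Proof.
move=> v u w /asboolP uv /asboolP vw.
by apply/asboolP; apply: vagner_trans uv vw.
Qed.

Canonical vagner_equiv (X : choiceType) : equiv_rel (word X) :=
  EquivRel (@vagnerb X) (@vagnerb_refl X) (@vagnerb_sym X) (@vagnerb_trans X).

Definition FIM (X : choiceType) : Type := {eq_quot (vagner_equiv X)}%qT.
HB.instance Definition _ (X : choiceType) := Choice.on (FIM X).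
HB.instance Definition _ (X : choiceType) := EqQuotient.on (FIM X).

Definition fim_pi (X : choiceType) (w : word X) : FIM X :=
  (\pi_(FIM X) w)%qT.

Lemma fim_piP (X : choiceType) (u v : word X) :
  fim_pi u = fim_pi v <-> vagner u v.
Proof.
split; first by move=> /eqmodP /asboolP.
by move=> uv; apply/eqmodP/asboolP.
Qed.

Lemma fim_pi_repr (X : choiceType) (a : FIM X) : fim_pi (repr a) = a.
Proof. exact: reprK. Qed.

Lemma fim_pi_surj (X : choiceType) (a : FIM X) : exists w, fim_pi w = a.
Proof. by exists (repr a); apply: fim_pi_repr. Qed.

Definition fim_one (X : choiceType) : FIM X := fim_pi [::].
Definition fim_mul (X : choiceType) (a b : FIM X) : FIM X :=
  fim_pi (repr a ++ repr b).

Lemma fim_pi_cat (X : choiceType) (u v : word X) :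
  fim_pi (u ++ v) = fim_mul (fim_pi u) (fim_pi v).
Proof.
by apply/fim_piP; apply: vagner_cat; apply/fim_piP; rewrite fim_pi_repr.
Qed.

Lemma fim_mulA (X : choiceType) : associative (@fim_mul X).
Proof.
move=> a b c; have [u <-] := fim_pi_surj a; have [v <-] := fim_pi_surj b.
by have [w <-] := fim_pi_surj c; rewrite -!fim_pi_cat catA.
Qed.

Lemma fim_mul1 (X : choiceType) : left_id (fim_one X) (@fim_mul X).
Proof. by move=> a; have [u <-] := fim_pi_surj a; rewrite -fim_pi_cat. Qed.

Lemma fim_mul_1 (X : choiceType) : right_id (fim_one X) (@fim_mul X).
Proof.
by move=> a; have [u <-] := fim_pi_surj a; rewrite -fim_pi_cat cats0.
Qed.

HB.instance Definition _ (X : choiceType) :=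
  isMonoid.Build (FIM X) (@fim_mulA X) (@fim_mul1 X) (@fim_mul_1 X).

Lemma fim_piM (X : choiceType) (u v : word X) :
  fim_pi (u ++ v) = (fim_pi u * fim_pi v)%g.
Proof. exact: fim_pi_cat. Qed.

Lemma fim_pi1 (X : choiceType) : fim_pi ([::] : word X) = 1%g.
Proof. by []. Qed.

Definition is_min (S : set nat) (n : nat) : Prop :=
  S n /\ forall m, S m -> n <= m.

Definition Geo (X : choiceType) (K : FIM X -> FIM X -> Prop) : set (word X) :=
  [set w | is_min [set size u | u in [set u | K (fim_pi u) (fim_pi w)]]
                  (size w)].


Record dfa (A : finType) := Dfa {
  dfa_state : finType;
  dfa_start : dfa_state;
  dfa_final : {set dfa_state};
  dfa_trans : dfa_state -> A -> dfa_state }.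

Definition dfa_lang (A : finType) (M : dfa A) : set (seq A) :=
  [set w | foldl (@dfa_trans A M) (dfa_start M) w \in dfa_final M].

Definition regular (A : finType) (L : set (seq A)) : Prop :=
  exists M : dfa A, dfa_lang M = L.

(* In a state q with Z on top of the stack, dpda_trans q (Some x) Z is the
   move reading x and dpda_trans q None Z the move reading no input; the
   result gives the new state and the string replacing Z, top first. *)
Record dpda (A : finType) := Dpda {
  dpda_state : finType;
  dpda_stack : finType;
  dpda_start : dpda_state;
  dpda_bottom : dpda_stack;
  dpda_final : {set dpda_state};
  dpda_trans : dpda_state -> option A -> dpda_stack ->
               option (dpda_state * seq dpda_stack);
  dpda_det : forall q Z, dpda_trans q None Z <> None ->
             forall x, dpda_trans q (Some x) Z = None }.

Definition dpda_config (A : finType) (M : dpda A) : Type :=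
  (dpda_state M * seq A * seq (dpda_stack M))%type.

Inductive dpda_step (A : finType) (M : dpda A) :
  dpda_config M -> dpda_config M -> Prop :=
| dpda_step_read q x w Z s q' t :
    dpda_trans q (Some x) Z = Some (q', t) ->
    dpda_step (q, x :: w, Z :: s) (q', w, t ++ s)
| dpda_step_eps q w Z s q' t :
    dpda_trans q None Z = Some (q', t) ->
    dpda_step (q, w, Z :: s) (q', w, t ++ s).

Definition dpda_lang (A : finType) (M : dpda A) : set (seq A) :=
  [set w | exists q s, q \in dpda_final M /\
     clos_refl_trans _ (@dpda_step A M)
       (dpda_start M, w, [:: dpda_bottom M]) (q, [::], s)].

Definition deterministic_context_free (A : finType) (L : set (seq A)) : Prop :=
  exists M : dpda A, dpda_lang M = L.

Record cfg (A : finType) := Cfg {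
  cfg_nonterm : finType;
  cfg_start : cfg_nonterm;
  cfg_prods : seq (cfg_nonterm * seq (cfg_nonterm + A)) }.

Inductive cfg_step (A : finType) (G : cfg A) :
  seq (cfg_nonterm G + A) -> seq (cfg_nonterm G + A) -> Prop :=
| cfg_step_prod u v N r : (N, r) \in cfg_prods G ->
    cfg_step (u ++ inl N :: v) (u ++ r ++ v).

Definition cfg_lang (A : finType) (G : cfg A) : set (seq A) :=
  [set w | clos_refl_trans _ (@cfg_step A G)
             [:: inl (cfg_start G)] (map inr w)].

Definition context_free (A : finType) (L : set (seq A)) : Prop :=
  exists G : cfg A, cfg_lang G = L.

Definition co_context_free (A : finType) (L : set (seq A)) : Prop :=
  context_free (~` L).

(* Main.v *)
From HB Require Import structures.
Require Import Defs.
From mathcomp Require Import all_boot all_order all_algebra zify.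
From mathcomp Require Import boolp classical_sets.
From Stdlib Require Import Relations.Relation_Operators.
From Stdlib Require Import Relations.Operators_Properties.

(** A word over a and its inverse is a walk on the integers that starts at 0.
Its image in the free inverse monoid is determined by the lowest point [lo],
the highest point [hi] and the end point [fin] of that walk ([vagnerP]): these
are unchanged by the Vagner relations, and every word reduces to a normal form
that dips to [lo], climbs to [hi] and comes back to [fin].  The R-class
remembers the interval from [lo] to [hi], the L-class the same interval seen
from the end point, the H-class everything, and the D-class only the width of
the interval ([greenRP], [greenLP], [greenHP], [greenDP]).

The minimal lengths are therefore those of shortest walks: the width for D;
the width plus a return trip to the nearer end for R, and for L by time
reversal; twice the width minus the distance from 0 to the end point for H.
Whether a word attains the minimum depends only on its run lengths, that is on
the sizes of its maximal blocks of equal letters ([minimal_alt]): at most one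
run for D; at most two runs for R, the second at least twice as long as the
first; the mirror image for L; at most three runs for H, where with three runs
the middle one is at least as long as the outer two together.

Having at most n runs is a regular condition, and each of the three
inequalities can be checked by a single counter that never moves without
reading a letter ([counter_dcf]).  The complement of such a language consists
of the words with too many runs, which is again regular, and of words with two
or three runs that satisfy the opposite inequality; the latter are generated by
grammars with one recursive variable ([context_free_two_blocks]), after cutting
the middle run into two pieces for H. *)

Set Implicit Arguments.
Unset Strict Implicit.
Unset Printing Implicit Defensive.

Import Order.TTheory GRing.Theory Num.Theory.

Local Open Scope classical_set_scope.

Local Notation aword := (word unit).
Local Notation positive := (all (leq 1)).

Definition atom (x : bool) : letter unit := (tt, x).

(** * The walk traced by a word *)

Section Walk.
Local Open Scope ring_scope.

Definition shift (c : letter unit) : int := if c.2 then 1 else -1.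

Fixpoint fin (w : aword) : int := if w is c :: w' then shift c + fin w' else 0.
Fixpoint lo (w : aword) : int :=
  if w is c :: w' then Num.min 0 (shift c + lo w') else 0.
Fixpoint hi (w : aword) : int :=
  if w is c :: w' then Num.max 0 (shift c + hi w') else 0.

Lemma walk_bounds w : [/\ lo w <= 0, 0 <= hi w, lo w <= fin w & fin w <= hi w].
Proof. by elim: w => //= c w [? ? ? ?]; split; lia. Qed.

Lemma fin_cat u v : fin (u ++ v) = fin u + fin v.
Proof. by elim: u => /= [|c u ->]; lia. Qed.

Lemma lo_cat u v : lo (u ++ v) = Num.min (lo u) (fin u + lo v).
Proof. by have [? ? ? ?] := walk_bounds v; elim: u => /= [|c u ->]; lia. Qed.

Lemma hi_cat u v : hi (u ++ v) = Num.max (hi u) (fin u + hi v).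
Proof. by have [? ? ? ?] := walk_bounds v; elim: u => /= [|c u ->]; lia. Qed.

Definition walk_cat := (fin_cat, lo_cat, hi_cat).

Lemma size_inv_word (w : aword) : size (inv_word w) = size w.
Proof. by rewrite /inv_word size_rev size_map. Qed.

Lemma walk_inv w : [/\ fin (inv_word w) = - fin w,
  lo (inv_word w) = lo w - fin w & hi (inv_word w) = hi w - fin w].
Proof.
elim: w => //= -[[] x] w [IHf IHl IHh]; have [? ? ? ?] := walk_bounds w.
have -> : inv_word ((tt, x) :: w) = inv_word w ++ [:: atom (~~ x)].
  by rewrite /inv_word /= rev_cons -cats1.
by rewrite !walk_cat IHf IHl IHh /= /shift; case: x; split=> /=; lia.
Qed.

Lemma fin_inv w : fin (inv_word w) = - fin w. Proof. by case: (walk_inv w). Qed.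
Lemma lo_inv w : lo (inv_word w) = lo w - fin w.
Proof. by case: (walk_inv w). Qed.
Lemma hi_inv w : hi (inv_word w) = hi w - fin w.
Proof. by case: (walk_inv w). Qed.
Definition walkE := (walk_cat, fin_inv, lo_inv, hi_inv).

Lemma fin_nseq i x : fin (nseq i (atom x)) = shift (atom x) * i%:Z.
Proof. by elim: i => /= [|i ->]; rewrite /shift; case: x => /=; lia. Qed.

Lemma lo_nseq i x : lo (nseq i (atom x)) = if x then 0 else - i%:Z.
Proof. by elim: i => /= [|i ->]; rewrite /shift; case: x => /=; lia. Qed.

Lemma hi_nseq i x : hi (nseq i (atom x)) = if x then i%:Z else 0.
Proof. by elim: i => /= [|i ->]; rewrite /shift; case: x => /=; lia. Qed.
Definition walk_nseq := (fin_nseq, lo_nseq, hi_nseq).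

(** * The word problem of the monogenic free inverse monoid *)

Definition same_walk u v := [/\ fin u = fin v, lo u = lo v & hi u = hi v].

Lemma vagner_same_walk u v : vagner u v -> same_walk u v.
Proof.
rewrite /same_walk; elim => {u v}.
- by [].
- by move=> u v _ [-> -> ->].
- by move=> u v w _ [-> -> ->] _ [-> -> ->].
- by move=> u u' v v' _ [f l h] _ [f' l' h']; rewrite !walk_cat f l h f' l' h'.
- by move=> u; have [] := walk_bounds u; rewrite !walkE; split; lia.
- move=> u v; have [] := walk_bounds u; have [] := walk_bounds v.
  by rewrite !walkE; split; lia.
Qed.

Local Open Scope group_scope.

Lemma fim_pi_regular u :
  fim_pi u * fim_pi (inv_word u) * fim_pi u = fim_pi u :> FIM unit.
Proof.
by rewrite -!fim_piM -catA; apply/fim_piP; apply: vagner_regular.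
Qed.

Lemma fim_pi_commute u v :
  commute (fim_pi u * fim_pi (inv_word u) : FIM unit)
          (fim_pi v * fim_pi (inv_word v)).
Proof. by rewrite /commute -!fim_piM; apply/fim_piP; apply: vagner_idem_comm. Qed.

Local Notation A := (fim_pi [:: atom true] : FIM unit).
Local Notation B := (fim_pi [:: atom false] : FIM unit).

Lemma fim_pi_nseq i x :
  fim_pi (nseq i (atom x)) = (fim_pi [:: atom x] : FIM unit) ^+ i.
Proof. by elim: i => //= i IH; rewrite -cat1s fim_piM IH expgS. Qed.

Lemma inv_nseq i x : inv_word (nseq i (atom x)) = nseq i (atom (~~ x)).
Proof. by rewrite /inv_word map_nseq rev_nseq. Qed.

Lemma fim_ABA : A * B * A = A.
Proof. exact: (fim_pi_regular [:: atom true]). Qed.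

Lemma fim_BAB : B * A * B = B.
Proof. exact: (fim_pi_regular [:: atom false]). Qed.

(** Going up and down again, and going down and up again, are both words of
the form u u^-1, so they commute; the two lemmas after this one are the only
rewritings needed to append a letter to a normal form. *)
Lemma fim_peak_commute k : commute (A ^+ k * B ^+ k) (B * A).
Proof.
rewrite -!fim_pi_nseq -(inv_nseq _ true).
exact: (fim_pi_commute _ [:: atom false]).
Qed.

(** Appending a to a normal form that ends below its top: the letter retraces
the last step of the final descent. *)
Lemma fim_peak_absorb k : A ^+ k.+1 * B ^+ k.+1 * A = A ^+ k.+1 * B ^+ k.
Proof.
rewrite expgS (expgSr B) -!mulgA (mulgA _ _ (B * A)) fim_peak_commute.
by rewrite !mulgA fim_ABA.
Qed.

(** Appending a^-1 to a normal form that ends at its bottom: the new lowest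
point may as well be visited at the start of the walk. *)
Lemma fim_peak_shift k : A ^+ k * B ^+ k * B = B * (A ^+ k.+1 * B ^+ k.+1).
Proof.
rewrite expgS (expgSr B) !mulgA -(mulgA (B * A)) -fim_peak_commute.
by rewrite -!mulgA [B * (A * B)]mulgA fim_BAB.
Qed.

(** The walk that visits the bottom of its interval, then the top, then its end
point. *)
Definition normal_word m d k :=
  nseq m (atom false) ++ nseq d (atom true) ++ nseq k (atom false).

Lemma fim_pi_normal m d k :
  fim_pi (normal_word m d k) = B ^+ m * (A ^+ d * B ^+ k).
Proof. by rewrite !fim_piM !fim_pi_nseq. Qed.

(** The bounds say that the walk starts and ends inside the interval that its
middle run sweeps, so that its data determine m, d and k; the second one also
provides the ascent that [fim_peak_absorb] needs. *)
Lemma fim_normal_form (w : aword) : exists m d k,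
  [/\ (m <= d)%N, (k <= d)%N & fim_pi w = fim_pi (normal_word m d k)].
Proof.
elim/last_ind: w => [|w [[] x] [m [d [k [md kd Ew]]]]].
  by exists 0%N, 0%N, 0%N.
rewrite -cats1 fim_piM {}Ew fim_pi_normal; case: x.
- case: k kd => [|k] kd; [exists m, d.+1, 0%N | exists m, d, k].
    split; [lia | by [] |].
    by rewrite fim_pi_normal !expg0 !mulg1 -mulgA -expgSr.
  split=> //; first lia.
  rewrite fim_pi_normal -[d](subnK kd) expgnDr -!mulgA; congr (_ * (_ * _)).
  by rewrite [LHS]mulgA fim_peak_absorb.
- have [kd' | dk] := ltnP k d; [exists m, d, k.+1 | exists m.+1, d.+1, d.+1].
    by split=> //; rewrite fim_pi_normal -!mulgA -expgSr.
  have {kd dk} -> : k = d by lia.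
  split=> //; rewrite fim_pi_normal expgSr -!mulgA; congr (_ * _).
  by rewrite [LHS]mulgA fim_peak_shift.
Qed.

Lemma walk_normal m d k : (m <= d)%N -> (k <= d)%N ->
  [/\ fin (normal_word m d k) = d%:Z - m%:Z - k%:Z,
      lo (normal_word m d k) = - m%:Z & hi (normal_word m d k) = d%:Z - m%:Z]%R.
Proof. by move=> ? ?; rewrite !(walk_cat, walk_nseq) /shift /=; split; lia. Qed.

Lemma vagnerP u v : vagner u v <-> same_walk u v.
Proof.
split=> [/vagner_same_walk //|].
have [m [d [k [md kd /fim_piP Eu]]]] := fim_normal_form u.
have [m' [d' [k' [md' kd' /fim_piP Ev]]]] := fim_normal_form v.
have [fu lu hu] := vagner_same_walk Eu; have [fv lv hv] := vagner_same_walk Ev.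
rewrite /same_walk fu lu hu fv lv hv.
have [-> -> ->] := walk_normal md kd; have [-> -> ->] := walk_normal md' kd'.
move=> [Ef El Eh].
have [Em Ed Ek] : [/\ m = m', d = d' & k = k'] by split; lia.
by apply: vagner_trans Eu _; rewrite Em Ed Ek; apply: vagner_sym.
Qed.

Lemma fim_piE u v : fim_pi u = fim_pi v :> FIM unit <-> same_walk u v.
Proof. by rewrite fim_piP; apply: vagnerP. Qed.

Close Scope group_scope.

(** * Green's relations read off the walk *)

(** Multiplying on the right can only enlarge the interval of u, and if v has
the same interval, then u u^-1 v and v trace walks with the same data. *)
Lemma greenRP (u v : aword) :
  greenR (fim_pi u) (fim_pi v) <-> lo u = lo v /\ hi u = hi v.
Proof.
have half x y : right_ideal (fim_pi x) = right_ideal (fim_pi y) ->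
    lo y <= lo x /\ hi x <= hi y.
  move=> E; have : right_ideal (fim_pi x) (fim_pi y).
    by rewrite E; exists 1%g => //; rewrite mulg1.
  move=> [z _]; have [t <-] := fim_pi_surj z.
  by rewrite -fim_piM => /fim_piE []; rewrite !walk_cat; lia.
split=> [E|[El Eh]].
  by have := half _ _ E; have := half _ _ (esym E); lia.
suff sub x y : lo x = lo y -> hi x = hi y ->
    right_ideal (fim_pi x) `<=` right_ideal (fim_pi y).
  by apply/seteqP; split; apply: sub.
move=> {El Eh} El Eh _ [z _ <-]; have [t <-] := fim_pi_surj z.
exists (fim_pi (inv_word y ++ x ++ t)) => //; rewrite -!fim_piM; apply/fim_piE.
have := walk_bounds x; have := walk_bounds y; have := walk_bounds t.
by move=> [? ? ? ?] [? ? ? ?] [? ? ? ?]; rewrite /same_walk !walkE; split; lia.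
Qed.

(** The dual of [greenRP], with the interval measured from the end point. *)
Lemma greenLP (u v : aword) : greenL (fim_pi u) (fim_pi v) <->
  lo u - fin u = lo v - fin v /\ hi u - fin u = hi v - fin v.
Proof.
have half x y : left_ideal (fim_pi x) = left_ideal (fim_pi y) ->
    lo y - fin y <= lo x - fin x /\ hi x - fin x <= hi y - fin y.
  move=> E; have : left_ideal (fim_pi x) (fim_pi y).
    by rewrite E; exists 1%g => //; rewrite mul1g.
  move=> [z _]; have [t <-] := fim_pi_surj z.
  by rewrite -fim_piM => /fim_piE []; rewrite !walk_cat; lia.
split=> [E|[El Eh]].
  by have := half _ _ E; have := half _ _ (esym E); lia.
suff sub x y : lo x - fin x = lo y - fin y -> hi x - fin x = hi y - fin y ->
    left_ideal (fim_pi x) `<=` left_ideal (fim_pi y).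
  by apply/seteqP; split; apply: sub.
move=> {El Eh} El Eh _ [z _ <-]; have [t <-] := fim_pi_surj z.
exists (fim_pi (t ++ x ++ inv_word y)) => //; rewrite -!fim_piM; apply/fim_piE.
have := walk_bounds x; have := walk_bounds y; have := walk_bounds t.
by move=> [? ? ? ?] [? ? ? ?] [? ? ? ?]; rewrite /same_walk !walkE; split; lia.
Qed.

Lemma greenDP (u v : aword) :
  greenD (fim_pi u) (fim_pi v) <-> hi u - lo u = hi v - lo v.
Proof.
split=> [[z]|E].
  by have [t <-] := fim_pi_surj z; move=> [/greenLP ? /greenRP ?]; lia.
have [? ? ? ?] := walk_bounds u; have [? ? ? ?] := walk_bounds v.
(* The middle element has the interval of v and ends where the interval of u,
   slid onto that of v, carries the end of u. *)
pose c := normal_word `|lo v| `|hi v - lo v| `|hi u - fin u|.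
have [fc lc hc] : [/\ fin c = hi v - hi u + fin u, lo c = lo v & hi c = hi v].
  have [||fc lc hc] := @walk_normal `|lo v| `|hi v - lo v| `|hi u - fin u|.
  - by lia.
  - by lia.
  - by rewrite /c fc lc hc; split; lia.
by exists (fim_pi c); rewrite greenLP greenRP fc lc hc; split; lia.
Qed.

Lemma greenHP (u v : aword) : greenH (fim_pi u) (fim_pi v) <-> same_walk u v.
Proof.
rewrite /greenH greenLP greenRP /same_walk.
by split=> [[[? ?] [? ?]]|[? ? ?]]; repeat split; lia.
Qed.

(** * Minimal lengths *)

Definition lenD w := hi w - lo w.
Definition lenR w := hi w - lo w + Num.min (hi w) (- lo w).
Definition lenL w := hi w - lo w + Num.min (hi w - fin w) (fin w - lo w).
Definition lenH w := 2 * (hi w - lo w) - `|fin w|.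

(** Putting one letter in front of a walk raises this quantity by at most one,
since the interval slides by one, and it grows only if 0 was an end of it, in
which case the nearer end is still 0. *)
Lemma lenR_ge w : lenR w <= (size w)%:Z.
Proof.
rewrite /lenR; elim: w => //= c w; have [? ? ? ?] := walk_bounds w.
by rewrite /shift; case: c.2; lia.
Qed.

Lemma lenH_ge w : lenH w <= (size w)%:Z.
Proof.
rewrite /lenH; elim: w => //= c w; have [? ? ? ?] := walk_bounds w.
by rewrite /shift; case: c.2; lia.
Qed.

(** The L-bound is the R-bound of the inverse word. *)
Lemma lenL_ge w : lenL w <= (size w)%:Z.
Proof.
rewrite -size_inv_word; apply: le_trans (lenR_ge (inv_word w)).
by rewrite /lenR /lenL !walkE; lia.
Qed.

Lemma lenD_ge w : lenD w <= (size w)%:Z.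
Proof.
apply: le_trans (lenR_ge w); rewrite /lenD /lenR.
by have [? ? ? ?] := walk_bounds w; lia.
Qed.

(** A lower bound for the length that is constant on K-classes and attained in
each of them is the minimal length. *)
Lemma Geo_len (K : FIM unit -> FIM unit -> Prop) (len : aword -> int) :
    (forall u v : aword, K (fim_pi u) (fim_pi v) -> len u = len v) ->
    (forall w, len w <= (size w)%:Z) ->
    (forall w : aword,
       exists u : aword, K (fim_pi u) (fim_pi w) /\ (size u)%:Z = len w) ->
  Geo K = [set w | len w = (size w)%:Z].
Proof.
move=> K_len len_le len_ex; apply/seteqP; split=> w /=.
  move=> [_ minw]; have [u [Kuw Eu]] := len_ex w.
  apply/eqP; rewrite eq_le len_le /= -Eu lez_nat; apply: minw; by exists u.
move=> Ew; split=> [|_ [u Kuw <-]].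
  have [u [Kuw]] := len_ex w; rewrite Ew => -[Eu]; by exists u.
by rewrite -lez_nat -Ew -(K_len _ _ Kuw).
Qed.

(** * Run lengths *)

(** Words are presented by their first letter and their run lengths.  Zero
lengths are allowed here, so that this is a total function; with positive
lengths the presentation is unique, which is [blocks_alt]. *)
Fixpoint alt (x : bool) (s : seq nat) : aword :=
  if s is i :: s' then nseq i (atom x) ++ alt (~~ x) s' else [::].

Fixpoint blocks (w : aword) : seq nat :=
  if w is c :: w' then
    if (w', blocks w') is (d :: _, i :: s) then
      if c == d then i.+1 :: s else [:: 1, i & s]
    else [:: 1]
  else [::].

Lemma blocks_nseq i x : blocks (nseq i.+1 (atom x)) = [:: i.+1].
Proof. by elim: i => // i; rewrite /= => ->; rewrite eqxx. Qed.

Lemma blocks_cat i x w :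
  blocks (nseq i.+1 (atom x) ++ atom (~~ x) :: w) =
  i.+1 :: blocks (atom (~~ x) :: w).
Proof.
have [n [s E]] : exists n s, blocks (atom (~~ x) :: w) = n :: s.
  by rewrite /=; case: w (blocks w) => [|d w] [|n s]; try case: eqP;
     do ?eexists.
have step c d v : blocks (c :: d :: v) = if blocks (d :: v) is i' :: s'
    then if c == d then i'.+1 :: s' else [:: 1, i' & s'] else [:: 1] by [].
elim: i => [|i IHi]; first by rewrite step E; case: x {E}.
by rewrite [LHS]step -[atom x :: _]/(nseq i.+1 (atom x) ++ _) IHi eqxx.
Qed.

Lemma blocks_alt x s : positive s -> blocks (alt x s) = s.
Proof.
elim: s x => // -[//|i] s IHs x ps; have := IHs (~~ x) ps.
case: s ps {IHs} => [|[//|j] s] _ E; first by rewrite /alt cats0 blocks_nseq.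
by rewrite -{2}E -blocks_cat.
Qed.

Lemma alt_surj (w : aword) : exists x s, positive s /\ w = alt x s.
Proof.
elim: w => [|[[] x] w [y [s [ps ->]]]]; first by exists true, [::].
case: s ps => [|[//|i] s] ps; first by exists x, [:: 1].
have [<-|neq_xy] := eqVneq x y; first by exists x, (i.+2 :: s).
by exists x, [:: 1, i.+1 & s]; split=> //; case: x y neq_xy {ps} => [] [].
Qed.

(** An R-geodesic goes to the nearer end of its interval, then back and on to
the other end; an L-geodesic is such a walk reversed in time.  An H-geodesic
may turn a second time, but does not come back across 0. *)
Definition okD (s : seq nat) := (size s <= 1)%N.
Definition okR (s : seq nat) :=
  if s is [:: i; k] then (i.*2 <= k)%N else (size s <= 1)%N.
Definition okL (s : seq nat) :=
  if s is [:: k; i] then (i.*2 <= k)%N else (size s <= 1)%N.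
Definition okH (s : seq nat) :=
  if s is [:: i; j; k] then (i + k <= j)%N else (size s <= 2)%N.

Definition block_lang (ok : pred (seq nat)) : set aword :=
  [set w | ok (blocks w)].

(** The part v of a word after its fourth run matters only through its walk
data, and the bounds [lenR_ge] and [lenH_ge] for v show that the whole word is
too long. *)
Lemma minimal_alt x s (w := alt x s) : positive s ->
  [/\ (lenD w == size w) = okD s, (lenR w == size w) = okR s,
      (lenL w == size w) = okL s & (lenH w == size w) = okH s].
Proof.
rewrite {}/w /okD /okR /okL /okH.
case: s => [|i [|j [|k [|l s]]]] /=; first by split.
- rewrite cats0 andbT /lenD /lenR /lenL /lenH !walk_nseq size_nseq /shift /=.
  by case: x => i_gt0; split; lia.
- rewrite cats0 andbT /lenD /lenR /lenL /lenH !(walk_cat, walk_nseq) /shift.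
  by rewrite size_cat !size_nseq; case: x => /= /andP[i_gt0 j_gt0]; split; lia.
- rewrite cats0 andbT /lenD /lenR /lenL /lenH !(walk_cat, walk_nseq) /shift.
  rewrite !size_cat !size_nseq; by case: x => /= /and3P[? ? ?]; split; lia.
set v := alt _ s => /and5P[i_gt0 j_gt0 k_gt0 l_gt0 ps].
have [? ? ? ?] := walk_bounds v; have := lenH_ge v; have := lenR_ge v.
rewrite /lenD /lenR /lenL /lenH !(walk_cat, walk_nseq) /shift.
rewrite !size_cat !size_nseq; clearbody v.
by case: x => /=; split; lia.
Qed.

Lemma Geo_blocks (K : FIM unit -> FIM unit -> Prop) (len : aword -> int) ok :
    (forall x s, positive s ->
       (len (alt x s) == size (alt x s)) = ok s) ->
    (forall u v : aword, K (fim_pi u) (fim_pi v) -> len u = len v) ->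
    (forall w, len w <= (size w)%:Z) ->
    (forall w : aword,
       exists u : aword, K (fim_pi u) (fim_pi w) /\ (size u)%:Z = len w) ->
  Geo K = block_lang ok.
Proof.
move=> ok_len K_len len_le len_ex; rewrite (Geo_len K_len) //.
by apply/seteqP; split=> w /=; rewrite /block_lang /=;
  have [x [s [ps ->]]] := alt_surj w; rewrite blocks_alt // -(ok_len x) // => /eqP.
Qed.

Lemma Geo_D : Geo (@greenD (FIM unit)) = block_lang okD.
Proof.
apply: (@Geo_blocks _ lenD).
- by move=> x s ps; have [] := minimal_alt x ps.
- by move=> u v /greenDP; rewrite /lenD; lia.
- exact: lenD_ge.
- move=> w; exists (nseq `|lenD w| (atom true)); have [? ? ? ?] := walk_bounds w.
  by rewrite greenDP size_nseq !walk_nseq /lenD; split; lia.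
Qed.

(** Shortest walk with a given interval: the nearer end is visited first. *)
Definition geoR w : aword :=
  if hi w <= - lo w then nseq `|hi w| (atom true) ++ nseq `|lenD w| (atom false)
  else nseq `|lo w| (atom false) ++ nseq `|lenD w| (atom true).

Lemma geoR_walk w :
  [/\ lo (geoR w) = lo w, hi (geoR w) = hi w & (size (geoR w))%:Z = lenR w].
Proof.
rewrite /geoR /lenD /lenR; have [? ? ? ?] := walk_bounds w.
by case: ifP => ?; rewrite !(walk_cat, walk_nseq) size_cat !size_nseq /shift /=;
  split; lia.
Qed.

Lemma Geo_R : Geo (@greenR (FIM unit)) = block_lang okR.
Proof.
apply: (@Geo_blocks _ lenR).
- by move=> x s ps; have [] := minimal_alt x ps.
- by move=> u v /greenRP; rewrite /lenR; lia.
- exact: lenR_ge.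
- by move=> w; exists (geoR w); have [? ? ?] := geoR_walk w; rewrite greenRP.
Qed.

Lemma Geo_L : Geo (@greenL (FIM unit)) = block_lang okL.
Proof.
apply: (@Geo_blocks _ lenL).
- by move=> x s ps; have [] := minimal_alt x ps.
- by move=> u v /greenLP; rewrite /lenL; lia.
- exact: lenL_ge.
- move=> w; exists (inv_word (geoR (inv_word w))).
  have [] := geoR_walk (inv_word w); rewrite greenLP size_inv_word.
  by rewrite /lenR /lenL !walkE; split; lia.
Qed.

(** Shortest walk with a given interval and end point: the end of the
interval away from the end point is visited first. *)
Definition geoH w : aword :=
  if 0 <= fin w then normal_word `|lo w| `|lenD w| `|hi w - fin w|
  else nseq `|hi w| (atom true) ++ nseq `|lenD w| (atom false) ++
       nseq `|fin w - lo w| (atom true).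

Lemma Geo_H : Geo (@greenH (FIM unit)) = block_lang okH.
Proof.
apply: (@Geo_blocks _ lenH).
- by move=> x s ps; have [] := minimal_alt x ps.
- by move=> u v /greenHP; rewrite /lenH => -[-> -> ->].
- exact: lenH_ge.
- move=> w; exists (geoH w); have [? ? ? ?] := walk_bounds w.
  rewrite greenHP /same_walk /geoH /lenD /lenH.
  by case: ifP => ?; rewrite !(walk_cat, walk_nseq) !size_cat !size_nseq /shift;
    split=> /=; try split; lia.
Qed.

End Walk.

(** * Real-time counter machines *)

(** A machine with a counter h tests whether h is positive, reads a letter, and
replaces h by h.-1 + t.  It is a pushdown automaton whose stack holds h copies
of one symbol above a bottom marker; t is the number of copies that replace the
top symbol, so that t = 0 pops, t = (0 < h) keeps and t = (0 < h).+1 pushes.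
There are no silent moves, so determinism is automatic and the run on a word is
a function. *)
Section CounterMachine.
Variables (A Q : finType) (start : Q) (final : {set Q}).
Variable delta : Q -> A -> bool -> option (Q * nat).

Fixpoint run (q : Q) (h : nat) (w : seq A) : option Q :=
  if w is c :: w' then
    if delta q c (0 < h) is Some (q', t) then run q' (h.-1 + t) w' else None
  else Some q.

Definition accepts (w : seq A) : bool :=
  if run start 0 w is Some q then q \in final else false.

Definition counter_trans (q : Q) (o : option A) (Z : bool) :
    option (Q * seq bool) :=
  if o is Some c then
    if delta q c Z is Some (q', t) then
      Some (q', nseq t true ++ (if Z then [::] else [:: false]))
    else None
  else None.

Definition counter_dpda : dpda A :=
  @Dpda A Q bool start false final counter_trans
    (fun q Z abs => False_ind _ (abs erefl)).

Definition counter_stack h : seq bool := nseq h true ++ [:: false].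

Lemma counter_stackS h t q c w q' : delta q c (0 < h) = Some (q', t) ->
  @dpda_step A counter_dpda (q, c :: w, counter_stack h)
    (q', w, counter_stack (h.-1 + t)).
Proof.
move=> E; have -> : counter_stack h =
    (0 < h) :: if 0 < h then counter_stack h.-1 else [::] by case: h {E}.
have -> : counter_stack (h.-1 + t) = (nseq t true ++
    (if 0 < h then [::] else [:: false])) ++
    (if 0 < h then counter_stack h.-1 else [::]).
  rewrite /counter_stack addnC nseqD -!catA; congr (_ ++ _).
  by case: h {E} => [|h] /=; rewrite ?cats0.
by apply: dpda_step_read; rewrite /= E.
Qed.

(** The top symbol tells whether h is positive, so that a single transition can
apply, and it consumes a letter. *)
Lemma counter_step_inv q h w d :
  @dpda_step A counter_dpda (q, w, counter_stack h) d ->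
  exists c w' q' t, [/\ w = c :: w', delta q c (0 < h) = Some (q', t)
                      & d = (q', w', counter_stack (h.-1 + t))].
Proof.
move: {-1}(q, w, _) (erefl (q, w, counter_stack h)) => e Ee step.
case: step Ee => // {}q1 x w1 Z s q' t /=.
case E : (delta q1 x Z) => [[q2 t2]|] // [Eq2 Et] [Eq Ew Es]; subst q w q2 t.
exists x, w1, q', t2; have EZ : (0 < h) = Z by case: (h) Es => [|?] [].
split=> //; first by rewrite EZ.
congr (_, _, _); rewrite /counter_stack addnC nseqD -!catA; congr (_ ++ _).
by case: (h) Es => [|h'] [<- <-] //=; rewrite cats0.
Qed.

Lemma counter_run q h w qf :
  (exists s, clos_refl_trans _ (@dpda_step A counter_dpda)
     (q, w, counter_stack h) (qf, [::], s)) <-> run q h w = Some qf.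
Proof.
split=> [[s /clos_rt_rt1n_iff]|].
  elim: w q h => [|c w IHw] q h /= steps.
    inversion steps as [|d e step]; subst => //.
    by have [? [? [? [? []]]]] := counter_step_inv step.
  inversion steps as [|d e step rest]; subst.
  have [_ [_ [q' [t [[<- <-] -> Ed]]]]] := counter_step_inv step.
  by apply: IHw; rewrite -Ed.
elim: w q h => [|c w IHw] q h /=.
  by move=> [->]; exists (counter_stack h); apply: rt_refl.
case E : delta => [[q' t]|] // /IHw [s steps]; exists s.
by apply: rt_trans steps; apply/rt_step/counter_stackS.
Qed.

Lemma counter_dcf : deterministic_context_free [set w | accepts w].
Proof.
exists counter_dpda; apply/seteqP; split=> w /=; rewrite /accepts.
  move=> [q [s [qF steps]]].
  by have -> := (counter_run start 0 w q).1 (ex_intro _ s steps).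
case E : run => [q|] // qF; have [s steps] := (counter_run start 0 w q).2 E.
by exists q, s.
Qed.

End CounterMachine.

(** * Counter machines for the geodesics *)

Inductive phase := Start | Climb | Half | Down | Past | Back.

Definition phase_code p : 'I_6 :=
  match p with
  | Start => @Ordinal 6 0 isT | Climb => @Ordinal 6 1 isT
  | Half => @Ordinal 6 2 isT | Down => @Ordinal 6 3 isT
  | Past => @Ordinal 6 4 isT | Back => @Ordinal 6 5 isT
  end.

Definition phase_decode (i : 'I_6) : phase :=
  nth Start [:: Start; Climb; Half; Down; Past; Back] i.
Lemma phase_codeK : cancel phase_code phase_decode.
Proof. by case. Qed.
HB.instance Definition _ := Finite.copy phase (can_type phase_codeK).

(** The second component remembers the first letter of the word. *)
Definition state := (phase * bool)%type.

(** After a first run of length i the counter is i - 1, so that it reaches 0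
one letter pair before the requirement is met and acceptance can be decided
without a silent move.  In the second run two letters are read for each
decrement: [Half] is entered after the first letter of a pair. *)
Definition deltaR (q : state) (c : letter unit) (top : bool) :
    option (state * nat) :=
  let: (p, x) := q in
  match p, c.2 == x, top with
  | Start, _, _ => Some (Climb, c.2, 0)
  | Climb, true, _ => Some (Climb, x, top.+1)
  | Climb, false, _ | Down, false, _ => Some (Half, x, top : nat)
  | Half, false, true => Some (Down, x, 0)
  | Half, false, false => Some (Past, x, 0)
  | Past, false, _ => Some (Past, x, 0)
  | _, _, _ => None
  end.

(** The first run is counted in pairs, with its parity in the state ([Half] if
odd); each letter of the second run costs one pair.  The language is closed
under prefixes, so running out of pairs may simply block the machine. *)
Definition deltaL (q : state) (c : letter unit) (top : bool) :
    option (state * nat) :=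
  let: (p, x) := q in
  match p, c.2 == x, top with
  | Start, _, _ => Some (Half, c.2, 0)
  | Half, true, _ => Some (Climb, x, top.+1)
  | Climb, true, _ => Some (Half, x, top : nat)
  | Half, false, true | Climb, false, true | Down, false, true =>
      Some (Down, x, 0)
  | _, _, _ => None
  end.

(** In the second run the counter descends to 0 and then counts the excess over
the first run, which is what the third run may use.  A third run that starts
while the counter still descends is rejected by blocking. *)
Definition deltaH (q : state) (c : letter unit) (top : bool) :
    option (state * nat) :=
  let: (p, x) := q in
  match p, c.2 == x, top with
  | Start, _, _ => Some (Climb, c.2, 1)
  | Climb, true, _ => Some (Climb, x, top.+1)
  | Climb, false, true | Down, false, true => Some (Down, x, 0)
  | Down, false, false => Some (Past, x, 1)
  | Past, false, _ => Some (Past, x, top.+1)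
  | Past, true, true | Back, true, true => Some (Back, x, 0)
  | _, _, _ => None
  end.

Lemma negb_eqF x : (~~ x == x) = false. Proof. by case: x. Qed.

Lemma runR_climb x h i w :
  run deltaR (Climb, x) h (nseq i (atom x) ++ w) =
  run deltaR (Climb, x) (h + i) w.
Proof.
elim: i h => [|i IHi] h /=; first by rewrite addn0.
by rewrite eqxx IHi; congr run; lia.
Qed.

Lemma runR_past x w j :
  run deltaR (Past, x) 0 (nseq j (atom (~~ x)) ++ w) = run deltaR (Past, x) 0 w.
Proof. by elim: j => //= j; rewrite negb_eqF. Qed.

Lemma runR_odd p x h w : p \in [:: Climb; Down] ->
  run deltaR (p, x) h (atom (~~ x) :: w) = run deltaR (Half, x) h w.
Proof.
by rewrite !inE => /orP[] /eqP->; case: h => [|h]; rewrite /= negb_eqF /= ?addn1.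
Qed.

Lemma runR_even x h w : run deltaR (Half, x) h (atom (~~ x) :: w) =
  if h is h'.+1 then run deltaR (Down, x) h' w else run deltaR (Past, x) 0 w.
Proof. by case: h => [|h]; rewrite /= negb_eqF /= ?addn0. Qed.

Lemma runR_enough p x h w : p \in [:: Climb; Down] ->
  run deltaR (p, x) h (nseq h.+1.*2 (atom (~~ x)) ++ w) = run deltaR (Past, x) 0 w.
Proof.
elim: h p => [|h IHh] p pP; rewrite doubleS [_ ++ _]/= runR_odd //.
  by rewrite runR_even.
by rewrite runR_even -[RHS](IHh Down).
Qed.

Lemma runR_short p x h j w : p \in [:: Climb; Down] -> 0 < j < h.+1.*2 ->
  exists q h', q \in [:: Half; Down] /\
    run deltaR (p, x) h (nseq j (atom (~~ x)) ++ w) = run deltaR (q, x) h' w.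
Proof.
elim: h p j => [|h IHh] p [|[|j]] pP // jP;
  rewrite [_ ++ _]/= runR_odd //.
- by exists Half, 0.
- by exists Half, h.+1.
rewrite runR_even; case: j jP => [_|j jP]; first by exists Down, h.
by apply: (IHh Down j.+1) => //; lia.
Qed.

Lemma alt_cons x i s : alt x (i :: s) = nseq i (atom x) ++ alt (~~ x) s.
Proof. by []. Qed.

Definition in_phases (ps : seq phase) : {set state} :=
  [set q : state | q.1 \in ps]%SET.

Lemma accepts_okR s x : positive s ->
  accepts (Start, true) (in_phases [:: Start; Climb; Past]) deltaR (alt x s) =
  okR s.
Proof.
rewrite /accepts /okR; case: s => [|[//|i] s] ps; first by rewrite /= inE.
have -> : run deltaR (Start, true) 0 (alt x (i.+1 :: s)) =
          run deltaR (Climb, x) i (alt (~~ x) s).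
  by rewrite /= runR_climb.
case: s ps => [|[//|k] s] ps; first by rewrite /= inE.
rewrite alt_cons negbK.
have [ik|ki] := leqP i.+1.*2 k.+1.
  have -> : k.+1 = i.+1.*2 + (k.+1 - i.+1.*2) by lia.
  rewrite nseqD -catA runR_enough // runR_past.
  by case: s ps => [|[//|l] s] _; rewrite /= ?inE // eqxx.
have [||q [h [qP ->]]] := @runR_short Climb x i k.+1 (alt x s) => //.
case: s ps => [|[//|l] s] _ /=; rewrite ?inE.
  by move: qP; rewrite !inE => /orP[] /eqP->; case: x.
by move: qP; rewrite !inE => /orP[] /eqP->; rewrite eqxx.
Qed.

(** Here cfg m is the configuration after m letters of the first run. *)
Lemma runL_climb x n i w :
  let cfg m := run deltaL (if odd m then Half else Climb, x) m./2 in
  cfg n (nseq i (atom x) ++ w) = cfg (n + i) w.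
Proof.
elim: i n => [|i IHi] n /=; first by rewrite addn0.
rewrite addnS -addSn -IHi /= uphalf_half.
by case: (odd n) => /=; rewrite eqxx; congr run; lia.
Qed.

Lemma runL_down x h j p w : p \in [:: Climb; Half; Down] ->
  run deltaL (p, x) h (nseq j.+1 (atom (~~ x)) ++ w) =
  if j < h then run deltaL (Down, x) (h - j.+1) w else None.
Proof.
move=> pP; have step h' v : run deltaL (p, x) h' (atom (~~ x) :: v) =
    if h' is h''.+1 then run deltaL (Down, x) h'' v else None.
  by move: pP; rewrite !inE => /or3P[] /eqP->; case: h' => [|h'] /=;
    rewrite negb_eqF //= addn0.
elim: j p h pP step => [|j IHj] p h pP step; rewrite [_ ++ _]/= step.
  by case: h => // h; rewrite subn1.
by case: h => // h; apply: (IHj Down) => // -[|h'] v /=; rewrite negb_eqF //= addn0.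
Qed.

Lemma accepts_okL s x : positive s ->
  accepts (Start, true) (in_phases [:: Start; Climb; Half; Down]) deltaL
    (alt x s) = okL s.
Proof.
rewrite /accepts /okL; case: s => [|[//|i] s] ps; first by rewrite /= inE.
have -> : run deltaL (Start, true) 0 (alt x (i.+1 :: s)) =
          run deltaL (if odd i.+1 then Half else Climb, x) i.+1./2 (alt (~~ x) s).
  by rewrite -[i.+1]add1n -runL_climb.
case: s ps => [|[//|k] s] ps; first by rewrite /= inE; case: ifP.
rewrite alt_cons negbK runL_down; last by case: ifP.
have -> : (k < i.+1./2) = (k.+1.*2 <= i.+1) by lia.
case: s ps => [|[//|l] s] _; case: leqP => _ //=; rewrite ?inE //.
by rewrite eqxx.
Qed.

Lemma runH_climb x h i w :
  run deltaH (Climb, x) h (nseq i (atom x) ++ w) =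
  run deltaH (Climb, x) (h + i) w.
Proof.
elim: i h => [|i IHi] h /=; first by rewrite addn0.
by rewrite eqxx IHi; congr run; lia.
Qed.

Lemma runH_past x h j w :
  run deltaH (Past, x) h (nseq j (atom (~~ x)) ++ w) =
  run deltaH (Past, x) (h + j) w.
Proof.
elim: j h => [|j IHj] h /=; first by rewrite addn0.
by rewrite negb_eqF IHj; congr run; lia.
Qed.

Lemma runH_down p x h j w : (p == Down) || (p == Climb) && (0 < h) ->
  run deltaH (p, x) h (nseq j.+1 (atom (~~ x)) ++ w) =
  if j < h then run deltaH (Down, x) (h - j.+1) w
  else run deltaH (Past, x) (j.+1 - h) w.
Proof.
elim: h p j => [|h IHh] p j.
  rewrite andbF orbF => /eqP-> /=; rewrite negb_eqF /= runH_past.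
  by congr run; lia.
move=> pP; have step v :
    run deltaH (p, x) h.+1 (atom (~~ x) :: v) = run deltaH (Down, x) h v.
  by case/orP: pP => [|/andP[]] /eqP-> => [|_] /=; rewrite negb_eqF /= addn0.
rewrite [_ ++ _]/= step; case: j => [|j]; first by rewrite subn1.
by rewrite (IHh Down).
Qed.

Lemma runH_back p x h k w : p \in [:: Past; Back] ->
  run deltaH (p, x) h (nseq k.+1 (atom x) ++ w) =
  if k < h then run deltaH (Back, x) (h - k.+1) w else None.
Proof.
move=> pP; have step h' v : run deltaH (p, x) h' (atom x :: v) =
    if h' is h''.+1 then run deltaH (Back, x) h'' v else None.
  by move: pP; rewrite !inE => /orP[] /eqP->; case: h' => [|h'] /=;
    rewrite eqxx //= addn0.
elim: k p h pP step => [|k IHk] p h pP step; rewrite [_ ++ _]/= step.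
  by case: h => // h; rewrite subn1.
by case: h => // h; apply: (IHk Back) => // -[|h'] v /=; rewrite eqxx //= addn0.
Qed.

Lemma accepts_okH s x : positive s ->
  accepts (Start, true) (in_phases [:: Start; Climb; Down; Past; Back]) deltaH
    (alt x s) = okH s.
Proof.
rewrite /accepts /okH; case: s => [|[//|i] s] ps; first by rewrite /= inE.
have -> : run deltaH (Start, true) 0 (alt x (i.+1 :: s)) =
          run deltaH (Climb, x) i.+1 (alt (~~ x) s).
  by rewrite /= runH_climb.
case: s ps => [|[//|j] s] ps; first by rewrite /= inE.
rewrite alt_cons negbK runH_down //.
case: s ps => [|[//|k] s] ps; first by case: ifP; rewrite /= inE.
case: ltnP => ij.
  by rewrite [alt _ _]/= [run _ _ _ _]/= eqxx; case: s {ps} => [|? ?] //; lia.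
rewrite alt_cons runH_back //.
case: s ps => [|[//|l] s] _; last first.
  by case: ifP => //=; rewrite negb_eqF.
by case: ltnP => /= jk; rewrite ?inE;
  apply/esym; [apply: (_ : is_true _)|apply/negbTE]; lia.
Qed.

Lemma block_lang_dcf (final : {set state}) delta ok :
    (forall s x, positive s ->
       accepts (Start, true) final delta (alt x s) = ok s) ->
  deterministic_context_free (block_lang ok).
Proof.
move=> okE; have := @counter_dcf _ _ (Start, true) final delta.
congr deterministic_context_free; apply/seteqP; split=> w /=;
  by have [x [s [ps ->]]] := alt_surj w; rewrite /block_lang /= blocks_alt // okE.
Qed.

(** * Context-free languages as least fixed points *)

Section Sem.
Variables (A N : Type).
Implicit Types (I J : N -> set (seq A)) (r : seq (N + A)).

(** The words matched by a sentential form when each variable n stands for the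
language I n. *)
Fixpoint sem I r (w : seq A) : Prop :=
  match r with
  | [::] => w = [::]
  | inr a :: r' => exists2 w', w = a :: w' & sem I r' w'
  | inl n :: r' => exists w1 w2, [/\ w = w1 ++ w2, I n w1 & sem I r' w2]
  end.

Lemma sem_cat I r1 r2 w : sem I (r1 ++ r2) w <->
  exists w1 w2, [/\ w = w1 ++ w2, sem I r1 w1 & sem I r2 w2].
Proof.
elim: r1 w => [|[n|a] r1 IHr] w /=.
- split=> [?|[_ [w2 [-> -> //]]]]; by exists [::], w.
- split=> [[w1 [w2 [-> In /IHr[u [v [-> ru rv]]]]]]|].
    exists (w1 ++ u), v; rewrite catA; split=> //.
    by exists w1, u.
  move=> [_ [v [-> [w1 [u [-> In ru]]] rv]]]; exists w1, (u ++ v).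
  by rewrite catA; split=> //; apply/IHr; exists u, v.
- split=> [[w1 -> /IHr[u [v [-> ru rv]]]]|].
    by exists (a :: u), v; split=> //; exists u.
  move=> [_ [v [-> [u -> ru] rv]]]; exists (u ++ v) => //.
  by apply/IHr; exists u, v.
Qed.

Lemma sem_word I u w : sem I (map inr u) w <-> w = u.
Proof.
elim: u w => [|a u IHu] w //=; split=> [[v -> /IHu -> //]|->].
by exists u => //; apply/IHu.
Qed.

Lemma sem_mono I J r w : (forall n, I n `<=` J n) -> sem I r w -> sem J r w.
Proof.
move=> IJ; elim: r w => [|[n|a] r IHr] w //=.
- by move=> [w1 [w2 [-> /IJ Jn /IHr rw]]]; exists w1, w2.
- by move=> [w1 -> /IHr]; exists w1.
Qed.

End Sem.

Lemma sem_rename A (N N' : Type) (f : N -> N') I r w :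
  @sem A N' I (map (fun s => match s with
    | inl n => inl (f n) | inr a => inr a end) r) w <-> sem (I \o f) r w.
Proof.
elim: r w => [|[n|a] r IHr] w //=.
- by split=> -[w1 [w2 [-> In /IHr ?]]]; exists w1, w2.
- by split=> -[w1 -> /IHr ?]; exists w1.
Qed.

Section Generated.
Variables (A : finType) (G : cfg A).
Implicit Types (I : cfg_nonterm G -> set (seq A)).

Definition closed_under I :=
  forall n r w, (n, r) \in cfg_prods G -> sem I r w -> I n w.

Definition generated n : set (seq A) :=
  [set w | forall I, closed_under I -> I n w].

Lemma generated_closed : closed_under generated.
Proof.
move=> n r w nr rw I closedI; apply: (closedI n r w nr).
by apply: sem_mono rw => m v; apply.
Qed.

Lemma sem_step I u v w :
  closed_under I -> cfg_step u v -> sem I v w -> sem I u w.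
Proof.
move=> closedI [{}u {}v n r nr].
move=> /sem_cat[w1 [_ [-> uw1 /sem_cat[w2 [w3 [-> rw2 vw3]]]]]].
apply/sem_cat; exists w1, (w2 ++ w3); split=> //.
by exists w2, w3; split=> //; apply: closedI nr rw2.
Qed.

Lemma derives_context u v x y :
  clos_refl_trans _ (@cfg_step A G) x y ->
  clos_refl_trans _ (@cfg_step A G) (u ++ x ++ v) (u ++ y ++ v).
Proof.
elim=> {x y} [_ _ [x y n r nr]|x|x y z _ xy _ yz].
- by rewrite -!catA !cat_cons !(catA u x); apply/rt_step/cfg_step_prod.
- exact: rt_refl.
- exact: rt_trans xy yz.
Qed.

Lemma sem_derives r w :
  sem (fun n v => clos_refl_trans _ (@cfg_step A G) [:: inl n] (map inr v)) r w ->
  clos_refl_trans _ (@cfg_step A G) r (map inr w).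
Proof.
elim: r w => [|[n|a] r IHr] w /=.
- by move=> ->; apply: rt_refl.
- move=> [w1 [w2 [-> nw1 /IHr rw2]]]; rewrite map_cat.
  apply: (rt_trans _ _ _ (map inr w1 ++ r)).
    exact: (derives_context [::] r nw1).
  by have := derives_context (map inr w1) [::] rw2; rewrite !cats0.
- move=> [w1 -> /IHr rw1].
  by have := derives_context [:: inr a] [::] rw1; rewrite !cats0.
Qed.

(** A grammar generates the least family of languages closed under its rules.
This replaces reasoning on derivations: an upper bound is proved by exhibiting a
closed family, and membership by using the closure of an arbitrary one. *)
Lemma cfg_langE : cfg_lang G = generated (cfg_start G).
Proof.
apply/seteqP; split=> w /= Gw.
  move=> I closedI; have : sem I [:: inl (cfg_start G)] w.
    have : sem I (map inr w) w by apply/sem_word.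
    elim: Gw => // [x y xy|x y z _ xy _ yz]; first exact: sem_step xy.
    by move/yz/xy.
  by move=> [w1 [_ [-> ? ->]]]; rewrite cats0.
apply: (Gw (fun n v => clos_refl_trans _ (@cfg_step A G) [:: inl n] (map inr v))).
move=> n r v nr /sem_derives; apply: rt_trans; apply: rt_step.
by have := cfg_step_prod [::] [::] nr; rewrite cats0.
Qed.

Lemma generated_least I : closed_under I -> forall n, generated n `<=` I n.
Proof. by move=> closedI n w; apply. Qed.

End Generated.

(** * Closure properties of context-free languages *)

Section Closure.
Variable A : finType.
Implicit Types L : set (seq A).

(** Add a new start symbol to the disjoint union of two grammars, with rules rs
that refer to the two old start symbols. *)
Lemma context_free_rules L1 L2 (rs : seq (seq (bool + A))) :
  context_free L1 -> context_free L2 ->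
  context_free [set w | exists2 r, r \in rs &
    sem (fun b => if b then L1 else L2) r w].
Proof.
move=> [G1 <-] [G2 <-].
pose N : finType := option (cfg_nonterm G1 + cfg_nonterm G2).
pose i1 (n : cfg_nonterm G1) : N := Some (inl n).
pose i2 (n : cfg_nonterm G2) : N := Some (inr n).
pose i0 (b : bool) : N := if b then i1 (cfg_start G1) else i2 (cfg_start G2).
pose ren T (f : T -> N) (r : seq (T + A)) : seq (N + A) :=
  map (fun s => match s with inl n => inl (f n) | inr a => inr a end) r.
pose prods : seq (N * seq (N + A)) :=
  [seq (None, ren _ i0 r) | r <- rs] ++
  [seq (i1 p.1, ren _ i1 p.2) | p <- cfg_prods G1] ++
  [seq (i2 p.1, ren _ i2 p.2) | p <- cfg_prods G2].
exists (@Cfg A N None prods); rewrite cfg_langE.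
apply/seteqP; split.
  pose I (n : N) : set (seq A) := match n with
    | None => [set w | exists2 r, r \in rs &
                 sem (fun b => if b then cfg_lang G1 else cfg_lang G2) r w]
    | Some (inl n) => generated n
    | Some (inr n) => generated n end.
  apply: (@generated_least _ (@Cfg A N None prods) I _ None) => n r v.
  rewrite !mem_cat => /or3P[] /mapP[].
  - move=> r' r'rs [-> ->] /sem_rename sr; exists r' => //.
    by apply: sem_mono sr => -[]; rewrite cfg_langE.
  - by move=> [m r'] mr [-> ->] /sem_rename; apply: generated_closed mr.
  - by move=> [m r'] mr [-> ->] /sem_rename; apply: generated_closed mr.
move=> w [r rrs rw] I closedI; apply: (closedI None (ren _ i0 r)).
  by rewrite mem_cat map_f.
apply/sem_rename; apply: sem_mono rw => -[]; rewrite cfg_langE;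
  [apply: (@generated_least _ G1 (I \o i1))
  |apply: (@generated_least _ G2 (I \o i2))].
- move=> m r' u mr' sr; apply: closedI; last by apply/sem_rename; apply: sr.
  by rewrite !mem_cat (map_f (fun p => (i1 p.1, ren _ i1 p.2)) mr') orbT.
- move=> m r' u mr' sr; apply: closedI; last by apply/sem_rename; apply: sr.
  by rewrite !mem_cat (map_f (fun p => (i2 p.1, ren _ i2 p.2)) mr') !orbT.
Qed.

Lemma context_free_union L1 L2 :
  context_free L1 -> context_free L2 -> context_free (L1 `|` L2).
Proof.
move=> cf1 cf2.
have := context_free_rules [:: [:: inl true]; [:: inl false]] cf1 cf2.
congr context_free; apply/seteqP; split=> w /=.
  move=> [r]; rewrite !inE => /orP[] /eqP-> /= [w1 [_ [-> ? ->]]]; rewrite cats0.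
    by left.
  by right.
by move=> [] Lw; [exists [:: inl true]|exists [:: inl false]] => //=;
  exists w, [::]; rewrite cats0.
Qed.

Lemma context_free_cat L1 L2 :
  context_free L1 -> context_free L2 ->
  context_free [set w | exists u v, [/\ w = u ++ v, L1 u & L2 v]].
Proof.
move=> cf1 cf2.
have := context_free_rules [:: [:: inl true; inl false]] cf1 cf2.
congr context_free; apply/seteqP; split=> w /=.
  move=> [r]; rewrite !inE => /eqP-> /= [u [_ [-> ? [v [_ [-> ? ->]]]]]].
  by exists u, v; rewrite cats0.
move=> [u [v [-> ? ?]]]; exists [:: inl true; inl false] => //=.
by exists u, v; split=> //; exists v, [::]; rewrite cats0.
Qed.

Lemma regular_context_free L : regular L -> context_free L.
Proof.
move=> [M <-].
pose N := dfa_state M.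
pose prods : seq (N * seq (N + A)) :=
  [seq (q, [::]) | q <- enum (dfa_final M)] ++
  [seq (p.1, [:: inr p.2; inl (dfa_trans p.1 p.2)]) | p <- enum {: N * A}].
pose G := @Cfg A N (dfa_start M) prods; exists G; rewrite cfg_langE.
pose I (q : N) : set (seq A) :=
  [set w | foldl (@dfa_trans A M) q w \in dfa_final M].
apply/seteqP; split.
  apply: (@generated_least _ G I) => q r w.
  rewrite mem_cat => /orP[] /mapP[p pP [-> ->]] /=.
    by move=> ->; rewrite /I /= -mem_enum.
  by move=> [v -> [w1 [_ [-> ? ->]]]]; rewrite cats0.
suff I_gen w q : I q w -> @generated _ G q w by move=> w; apply: I_gen.
elim: w q => [|a w IHw] q qw J closedJ.
  by apply: (closedJ q [::]); rewrite // mem_cat map_f // mem_enum.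
apply: (closedJ q [:: inr a; inl (dfa_trans q a)]).
  rewrite mem_cat; apply/orP; right; apply/mapP; exists (q, a) => //.
  by rewrite mem_enum.
exists w => //; exists w, [::]; rewrite cats0; split=> //.
exact: IHw qw J closedJ.
Qed.

Lemma regular_setC L : regular L -> regular (~` L).
Proof.
move=> [M <-]; exists (@Dfa A _ (dfa_start M) (~: dfa_final M)%SET (@dfa_trans A M)).
by apply/seteqP; split=> w /=; rewrite /dfa_lang /= inE => /negP.
Qed.

Definition two_blocks (a b : A) (P : nat -> nat -> bool) : set (seq A) :=
  [set w | exists i j, w = nseq i a ++ nseq j b /\ P i j].

(** The grammar has a single variable S, a terminal rule for a^i0 b^j0 and a rule
S -> a^d S b^e for each (d, e) in D; the first hypothesis says that P is what
one reaches from (i0, j0) by adding vectors of D. *)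
Lemma context_free_two_blocks a b P i0 j0 (D : seq (nat * nat)) :
    (forall i j, P i j = ((i, j) == (i0, j0)) ||
       has (fun d => [&& d.1 <= i, d.2 <= j & P (i - d.1) (j - d.2)]) D) ->
    all (fun d => 0 < d.1 + d.2) D ->
  context_free (two_blocks a b P).
Proof.
move=> PE Dpos.
pose prods : seq (unit * seq (unit + A)) :=
  (tt, map inr (nseq i0 a ++ nseq j0 b)) ::
  [seq (tt, map inr (nseq d.1 a) ++ inl tt :: map inr (nseq d.2 b)) | d <- D].
exists (@Cfg A unit tt prods); rewrite cfg_langE; apply/seteqP; split.
  apply: (@generated_least _ (@Cfg A unit tt prods) (fun=> two_blocks a b P)).
  move=> -[] r w.
  rewrite inE => /orP[/eqP[->] /sem_word ->|/mapP[[d e] dD [->]]].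
    by exists i0, j0; split=> //; rewrite PE eqxx.
  move=> /sem_cat[_ [_ [-> /sem_word -> [_ [_ [-> [i [j [-> Pij]]] /sem_word ->]]]]]].
  exists (d + i), (j + e); rewrite !nseqD -!catA; split=> //.
  rewrite PE; apply/orP; right; apply/hasP; exists (d, e) => //=.
  by rewrite leq_addr leq_addl addKn addnK.
move=> _ [i [j [-> Pij]]] J closedJ /=.
elim: {i j}_.+1 {-2}i {-2}j (ltnSn (i + j)) Pij => // m IHm i j ijm.
rewrite PE => /orP[/eqP[-> ->]|/hasP[[d e] dD /= /and3P[di ej Pij]]].
  by apply: (closedJ tt) (mem_head _ _) _; apply/sem_word.
have /= de_gt0 := allP Dpos _ dD.
apply: (closedJ tt (map inr (nseq d a) ++ inl tt :: map inr (nseq e b))).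
  by rewrite inE; apply/orP; right; apply/mapP; exists (d, e).
apply/sem_cat; exists (nseq d a), (nseq (i - d) a ++ nseq j b); split.
- by rewrite catA -nseqD subnKC.
- exact/sem_word.
exists (nseq (i - d) a ++ nseq (j - e) b), (nseq e b); split.
- by rewrite -catA -nseqD subnK.
- by apply: IHm => //; lia.
- exact/sem_word.
Qed.

End Closure.

(** * Complements of the geodesic languages *)

Section CountBlocks.
Variable n : nat.

(** A run starts where a letter differs from the last one read; counts of runs
beyond n need not be told apart. *)
Definition count_dfa : dfa (unit * bool)%type :=
  @Dfa _ (option bool * 'I_n.+2)%type (None, ord0)
    [set q : option bool * 'I_n.+2 | q.2 <= n]%SET
    (fun q c => (Some c.2,
       if q.1 == Some c.2 then q.2 else inord (minn n.+1 q.2.+1))).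

Lemma count_dfa_alt x s q : q.1 != Some x -> positive s ->
  (foldl (@dfa_trans _ count_dfa) q (alt x s)).2 = minn n.+1 (q.2 + size s) :> nat.
Proof.
elim: s x q => [|[//|i] s IHs] x q qx ps.
  by rewrite addn0; apply/esym/minn_idPr; rewrite -ltnS; apply: ltn_ord.
have -> : foldl (@dfa_trans _ count_dfa) q (alt x (i.+1 :: s)) =
    foldl (@dfa_trans _ count_dfa) (Some x, inord (minn n.+1 q.2.+1))
      (alt (~~ x) s).
  rewrite /= (negPf qx) foldl_cat; congr foldl.
  by elim: i {ps} => //= i; rewrite eqxx.
rewrite IHs //=; last by case: x {qx}.
by rewrite inordK /=; lia.
Qed.

Lemma regular_few_blocks :
  regular (block_lang (fun s => size s <= n)).
Proof.
exists count_dfa; apply/seteqP; split=> w; have [x [s [ps ->]]] := alt_surj w;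
  rewrite /dfa_lang /block_lang /= blocks_alt // inE count_dfa_alt //= add0n; lia.
Qed.

Lemma context_free_many_blocks :
  context_free (block_lang (fun s => n < size s)).
Proof.
have := regular_context_free (regular_setC regular_few_blocks).
by congr context_free; apply/seteqP; split=> w /=;
  rewrite /block_lang /= ltnNge => /negP.
Qed.

End CountBlocks.

(** Words with more than n runs form a regular language, so only the bad words
with few runs need a grammar; the letter x is the first letter of such a word. *)
Lemma co_context_free_blocks n ok (bad : bool -> set aword) :
    (forall s, n < size s -> ~~ ok s) ->
    (forall x, context_free (bad x)) ->
    (forall x w, bad x w -> ~~ ok (blocks w)) ->
    (forall x s, positive s -> size s <= n -> ~~ ok s -> bad x (alt x s)) ->
  co_context_free (block_lang ok).
Proof.
move=> many_bad bad_cf bad_sound bad_complete.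
have := context_free_union (context_free_many_blocks n)
  (context_free_union (bad_cf true) (bad_cf false)).
congr context_free; apply/seteqP; split=> w; rewrite /block_lang /=.
  by case=> [/many_bad/negP|[] /bad_sound/negP].
have [x [s [ps ->]]] := alt_surj w; rewrite blocks_alt // => /negP ok_s.
have [few|many] := leqP (size s) n; last by left.
by right; have := bad_complete x s ps few ok_s; case: x; [left | right].
Qed.

Lemma alt1 x i : alt x [:: i] = nseq i (atom x).
Proof. exact: cats0. Qed.

Lemma alt2 x i k : alt x [:: i; k] = nseq i (atom x) ++ nseq k (atom (~~ x)).
Proof. by rewrite alt_cons alt1. Qed.

Lemma okR_co_context_free : co_context_free (block_lang okR).
Proof.
apply: (@co_context_free_blocks 2 _
  (fun x => two_blocks (atom x) (atom (~~ x)) (fun i k => 0 < k < i.*2))).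
- by case=> [|? [|? [|? ?]]].
(* With i = 1 the only solution is k = 1, and raising i by one raises the
   largest admissible k by two. *)
- move=> x; apply: (@context_free_two_blocks _ _ _ _ 1 1
    [:: (1, 0); (1, 1); (1, 2)]) => //.
  by move=> i j; rewrite xpair_eqE /=; lia.
- by move=> x w [i [k [-> ik]]]; rewrite -alt2 blocks_alt /=; lia.
move=> x [|i [|k [|? ?]]] // ps _ ik; rewrite alt2.
by exists i, k; split=> //; move: ps ik => /=; lia.
Qed.

Lemma okL_co_context_free : co_context_free (block_lang okL).
Proof.
apply: (@co_context_free_blocks 2 _
  (fun x => two_blocks (atom x) (atom (~~ x)) (fun k i => 0 < k < i.*2))).
- by case=> [|? [|? [|? ?]]].
- move=> x; apply: (@context_free_two_blocks _ _ _ _ 1 1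
    [:: (0, 1); (1, 1); (2, 1)]) => //.
  by move=> i j; rewrite xpair_eqE /=; lia.
- by move=> x w [k [i [-> ik]]]; rewrite -alt2 blocks_alt /=; lia.
move=> x [|k [|i [|? ?]]] // ps _ ik; rewrite alt2.
by exists k, i; split=> //; move: ps ik => /=; lia.
Qed.

(** A run of length j < i + k between runs of lengths i and k is cut into
j - k < i letters, compared with the first run, and min (j, k) <= k letters,
compared with the third. *)
Lemma okH_co_context_free : co_context_free (block_lang okH).
Proof.
pose bad x : set aword := [set w | exists u v, [/\ w = u ++ v,
  two_blocks (atom x) (atom (~~ x)) (fun i j => j < i) u &
  two_blocks (atom (~~ x)) (atom x) (fun j k => 0 < j <= k) v]].
have badE x i j1 j2 k : nseq i (atom x) ++ nseq j1 (atom (~~ x)) ++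
    nseq j2 (atom (~~ x)) ++ nseq k (atom x) = alt x [:: i; j1 + j2; k].
  by rewrite alt_cons alt2 negbK nseqD -catA.
apply: (@co_context_free_blocks 3 _ bad).
- by case=> [|? [|? [|? [|? ?]]]].
- move=> x; apply: context_free_cat.
    apply: (@context_free_two_blocks _ _ _ _ 1 0 [:: (1, 0); (1, 1)]) => //.
    by move=> i j; rewrite xpair_eqE /=; lia.
  apply: (@context_free_two_blocks _ _ _ _ 1 1 [:: (0, 1); (1, 1)]) => //.
  by move=> i j; rewrite xpair_eqE /=; lia.
- move=> x w [_ [_ [-> [i [j1 [-> ij]]] [j2 [k [-> jk]]]]]].
  by rewrite -catA badE blocks_alt /=; lia.
move=> x [|i [|j [|k [|? ?]]]] // ps _ ijk; rewrite /= in ps ijk.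
exists (nseq i (atom x) ++ nseq (j - k) (atom (~~ x))).
exists (nseq (minn j k) (atom (~~ x)) ++ nseq k (atom x)); split.
- by rewrite -catA badE; congr alt; congr [:: _; _; _]; lia.
- by exists i, (j - k); split=> //; lia.
- by exists (minn j k), k; split=> //; lia.
Qed.

(* X = {a} is the one-element type unit. *)
Theorem theorem9p1 :
  [/\ regular (Geo (@greenD (FIM unit))),
      deterministic_context_free (Geo (@greenR (FIM unit))) /\
        co_context_free (Geo (@greenR (FIM unit))),
      deterministic_context_free (Geo (@greenL (FIM unit))) /\
        co_context_free (Geo (@greenL (FIM unit)))
    & deterministic_context_free (Geo (@greenH (FIM unit))) /\
        co_context_free (Geo (@greenH (FIM unit)))].
Proof.
rewrite Geo_D Geo_R Geo_L Geo_H.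
split; first exact: regular_few_blocks.
- by split; [apply: block_lang_dcf accepts_okR | apply: okR_co_context_free].
- by split; [apply: block_lang_dcf accepts_okL | apply: okL_co_context_free].
- by split; [apply: block_lang_dcf accepts_okH | apply: okH_co_context_free].
Qed.
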